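(* For every $n\ge 1$, $|\mathfrak{S}_n(\mathrm{A}_3,\mathrm{D}_3)|=2^{n-1}$.
   Context: $\mathfrak{S}_n$ is the set of permutations $\sigma=\sigma_1\sigma_2\cdots\sigma_n$ of $[n]=\{1,\dots,n\}$ in one-line notation. A mesh pattern is a pair $p=(\pi,R)$ with $\pi\in\mathfrak{S}_m$ and $R\subseteq\{0,\dots,m\}\times\{0,\dots,m\}$ (the set of shaded unit cells, each given by its bottom-left corner, in the grid with dots at $(i,\pi_i)$). An occurrence of $p$ in $\sigma\in\mathfrak{S}_n$ is a choice of indices $i_1<\cdots<i_m$ such that $\sigma_{i_1}\cdots\sigma_{i_m}$ is order-isomorphic to $\pi$ and, for every $(a,b)\in R$, there is no index $r$ with $i_a<r<i_{a+1}$ and $v_b<\sigma_r<v_{b+1}$; here $v_1<\cdots<v_m$ is the increasing rearrangement of $\sigma_{i_1},\dots,\sigma_{i_m}$, $i_0=v_0=0$ and $i_{m+1}=v_{m+1}=n+1$. $\mathfrak{S}_n(p,q)$ is the set of permutations in $\mathfrak{S}_n$ with no occurrence of $p$ and no occurrence of $q$. The mesh patterns: $\mathrm{A}_3=(123,\{(0,3),(3,0)\})$ and $\mathrm{D}_3=(321,\{(0,0),(3,3)\})$. *)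

(* Defs.v *)
From HB Require Import structures.
From mathcomp Require Import all_boot all_fingroup.
Set Implicit Arguments.
Unset Strict Implicit.
Unset Printing Implicit Defensive.

(* Permutations of [n] are elements of 'S_n, i.e. permutations of
   'I_n = {0, ..., n-1}: the entry sigma_i of the one-line notation is
   (s k).+1 with k = i - 1.  Shaded cells keep the usual coordinates in
   {0, ..., m} x {0, ..., m}. *)

Record mesh_pattern := MeshPattern {
  mesh_size : nat;
  mesh_perm : 'S_mesh_size;
  mesh_shade : {set 'I_mesh_size.+1 * 'I_mesh_size.+1}
}.

Section Occurrence.
Variables (n m : nat) (s : 'S_n) (i : {ffun 'I_m -> 'I_n}).

(* The sequences i_0, ..., i_{m+1} and v_0, ..., v_{m+1}, 1-based, with the
   conventions i_0 = v_0 = 0 and i_{m+1} = v_{m+1} = n + 1. *)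
Definition occ_positions : seq nat :=
  0 :: rcons [seq (i k).+1 | k <- enum 'I_m] n.+1.

Definition occ_values : seq nat :=
  0 :: rcons (sort leq [seq (s (i k)).+1 | k <- enum 'I_m]) n.+1.

Definition in_cell (a b : nat) (r : 'I_n) : bool :=
  [&& nth 0 occ_positions a < r.+1 < nth 0 occ_positions a.+1 &
      nth 0 occ_values b < (s r).+1 < nth 0 occ_values b.+1].

Definition increasing_indices : bool :=
  [forall j : 'I_m, forall k : 'I_m, (j < k) ==> (i j < i k)].

Definition order_isomorphic (pi : 'S_m) : bool :=
  [forall j : 'I_m, forall k : 'I_m, (s (i j) < s (i k)) == (pi j < pi k)].

End Occurrence.

Definition is_occurrence (p : mesh_pattern) (n : nat) (s : 'S_n)
    (i : {ffun 'I_(mesh_size p) -> 'I_n}) : bool :=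
  [&& increasing_indices i,
      order_isomorphic s i (mesh_perm p) &
      [forall c in mesh_shade p, [forall r : 'I_n, ~~ in_cell s i c.1 c.2 r]]].

Definition contains (p : mesh_pattern) (n : nat) (s : 'S_n) : bool :=
  [exists i : {ffun 'I_(mesh_size p) -> 'I_n}, is_occurrence s i].

Definition avoiders (n : nat) (p q : mesh_pattern) : {set 'S_n} :=
  [set s : 'S_n | ~~ contains p s && ~~ contains q s].

(* 123, with cells (0,3) and (3,0) shaded; ord0 and ord_max are 0 and 3 in
   'I_4. *)
Definition A3 : mesh_pattern :=
  @MeshPattern 3 (perm_one 'I_3) [set (ord0, ord_max); (ord_max, ord0)].

(* 321, with cells (0,0) and (3,3) shaded. *)
Definition D3 : mesh_pattern :=
  @MeshPattern 3 (perm (@rev_ord_inj 3)) [set (ord0, ord0); (ord_max, ord_max)].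

(* Main.v *)
Require Import Defs.
From mathcomp Require Import all_boot all_fingroup.
From mathcomp Require Import zify.
Set Implicit Arguments.
Unset Strict Implicit.
Unset Printing Implicit Defensive.

(** An avoider is determined by which of its later entries exceed its first
entry, and every such choice occurs; hence there are 2 ^ (n - 1) of them.

Number the positions 0, ..., m with m = n - 1, and let the word w of s have
the letter w r = (s 0 < s r) at each position r > 0.  The positions 1, ..., m
are peeled off one at a time from the two ends of an interval [lo, up), which
starts as [1, m + 1).  Let h = up - 1 be its last position.  The left end lo is
peeled when w lo = w h <> w up, and h is peeled otherwise; a position beyond m
carries the letter w m.  The number of steps that a position survives is its
depth.  This order depends on w alone.

The claim is that s avoids both patterns exactly when it is outward: each
position r', compared with any position r of smaller depth, has the value
farther from s 0 in the direction given by w r'.  In other words, the entries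
that remain always lie outside the range of the entries already peeled, so the
permutation spirals out from the value s 0 while its positions move in from
both ends.

If s avoids, outwardness follows by induction on the peeling: were the peeled
entry not the innermost remaining one of its letter, it would form, with a
remaining entry of that letter and a third, suitably chosen entry, a monotone
triple to which avoidance assigns a witness; but all candidates for the
witness have already been peeled and are on the wrong side
(peeled_innermost, mesh_avoiding_outward).  Conversely, if s is outward,
the least depth in a monotone triple belongs to one of its two outer
positions, and the rule that chooses the end to peel provides a witness
(witnessed_left_shallower, witnessed_right_shallower).

An outward sequence is ordered like the explicit sequence spiral m w, whence
the word determines the avoider; and the permutation ordered like spiral m w
is an avoider with word w.

Reversing the order of the values exchanges the two patterns.  A Boolean b
that reverses the order on nat when it is false treats both at once: up to b,
each pattern asks for a monotone triple i < j < k without a position left of i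
whose value lies beyond that of k and without a position right of k whose
value lies before that of i. *)

(** * Monotone triples in either direction *)

Definition dlt (b : bool) (x y : nat) : bool := if b then x < y else y < x.

Lemma dltN b x y : dlt (~~ b) x y = dlt b y x.
Proof. by case: b. Qed.

Lemma dlt_asym b x y : dlt b x y -> dlt b y x -> False.
Proof. by rewrite /dlt; case: b; lia. Qed.

Lemma dlt_trans b y x z : dlt b x y -> dlt b y z -> dlt b x z.
Proof. by rewrite /dlt; case: b; lia. Qed.

Lemma dlt_total b x y : x != y -> dlt b x y \/ dlt b y x.
Proof. by rewrite /dlt; case: b; lia. Qed.

Lemma dlt_orient b c x y : dlt b x y -> dlt c x y -> c = b.
Proof. by rewrite /dlt; case: b; case: c; lia. Qed.

(** A point of one of the two shaded corners, so that a triple with outer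
positions i and k is no occurrence of the pattern of direction b. *)
Definition witnessed (m : nat) (f : nat -> nat) (b : bool) (i k : nat) : Prop :=
  exists2 r, r <= m & (r < i /\ dlt b (f k) (f r)) \/ (k < r /\ dlt b (f r) (f i)).

Definition mesh_avoiding (m : nat) (f : nat -> nat) : Prop :=
  forall b i j k, i < j -> j < k -> k <= m ->
  dlt b (f i) (f j) -> dlt b (f j) (f k) -> witnessed m f b i k.

(** * Peeling the positions of a word from both ends *)

Section Peeling.

Variables (m : nat) (w : nat -> bool).

Definition peels_left (l u : nat) : bool := (w l == w u.-1) && (w u.-1 != w u).

Fixpoint lo (t : nat) : nat :=
  if t is t'.+1 then lo t' + peels_left (lo t') (lo t' + (m - t')) else 1.

(** The interval left after t steps is [lo t, up t); it has m - t positions. *)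
Definition up (t : nat) : nat := lo t + (m - t).

Definition remains (t r : nat) : bool := lo t <= r < up t.

Definition leftward (t : nat) : bool := peels_left (lo t) (up t).

Definition peeled (t : nat) : nat := if leftward t then lo t else (up t).-1.

Lemma loS t : lo t.+1 = lo t + leftward t.
Proof. by []. Qed.

Lemma lo_gt0 t : 0 < lo t.
Proof. by elim: t => // t IH; rewrite loS; lia. Qed.

Lemma lo_lt_up t : t < m -> lo t < up t.
Proof. by rewrite /up; lia. Qed.

Lemma upS t : t < m -> up t.+1 = up t - ~~ leftward t.
Proof. by move=> tm; rewrite {1}/up loS; case: (leftward t); rewrite /up /=; lia. Qed.

Lemma up_le t : t <= m -> up t <= m.+1.
Proof.
elim: t => [|t IH] tm; first by rewrite /up /=; lia.
by rewrite upS //; have := IH (ltnW tm); lia.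
Qed.

Lemma remains_lt t r : remains t r -> t < m.
Proof. by rewrite /remains /up; lia. Qed.

Lemma remains_ltN t r : r < lo t -> ~~ remains t r.
Proof. by rewrite /remains; lia. Qed.

Lemma remains_geN t r : up t <= r -> ~~ remains t r.
Proof. by rewrite /remains; lia. Qed.

Lemma remains_gt0 t r : remains t r -> 0 < r.
Proof. by have := lo_gt0 t; rewrite /remains; lia. Qed.

Lemma remains_le t r : remains t r -> r <= m.
Proof. by move=> rem; have := up_le (ltnW (remains_lt rem)); move: rem; rewrite /remains; lia. Qed.

Lemma remains_convex t i j k : remains t i -> remains t k -> i <= j <= k -> remains t j.
Proof. by rewrite /remains; lia. Qed.

Lemma remains0 r : remains 0 r = (0 < r <= m).
Proof. by rewrite /remains /up /=; lia. Qed.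

Lemma remains_lo t : t < m -> remains t (lo t).
Proof. by move=> tm; rewrite /remains leqnn lo_lt_up. Qed.

Lemma remains_up t : t < m -> remains t (up t).-1.
Proof. by move=> /lo_lt_up; rewrite /remains; lia. Qed.

Lemma remains_peeled t : t < m -> remains t (peeled t).
Proof. by rewrite /peeled => tm; case: ifP => _; rewrite (remains_lo, remains_up). Qed.

Lemma leftward_peeled t r : remains t r -> peeled t < r -> leftward t.
Proof. by rewrite /remains /peeled; case: leftward => //; lia. Qed.

Lemma rightward_peeled t r : remains t r -> r < peeled t -> ~~ leftward t.
Proof. by rewrite /remains /peeled; case: leftward => //; lia. Qed.

Lemma remainsS t r : t < m -> remains t.+1 r = remains t r && (r != peeled t).
Proof.
move=> tm; have := lo_lt_up tm; rewrite /remains upS // loS /peeled.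
by case: leftward => /=; lia.
Qed.

Lemma remains_m r : ~~ remains m r.
Proof. by rewrite /remains /up; lia. Qed.

Lemma remains_anti t u r : t <= u -> remains u r -> remains t r.
Proof.
elim: u => [|u IH]; first by rewrite leqn0 => /eqP->.
rewrite leq_eqVlt => /orP[/eqP-> //|tu] rem; apply: IH => //.
have um : u < m by have := remains_lt rem; lia.
by move: rem; rewrite remainsS // => /andP[].
Qed.

Lemma leaves r : exists t, ~~ remains t r.
Proof. by exists m; exact: remains_m. Qed.

Definition depth (r : nat) : nat := ex_minn (leaves r).

Lemma remainsE t r : remains t r = (t < depth r).
Proof.
rewrite /depth; case: ex_minnP => d nd dmin; case: ltnP => td.
  by apply: contraTT td => /dmin; lia.
by apply: contraNF nd; apply: remains_anti.
Qed.

Lemma depth_le r : depth r <= m.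
Proof. by rewrite leqNgt -remainsE remains_m. Qed.

Lemma depth0 : depth 0 = 0.
Proof. by have := remainsE 0 0; rewrite remains0; lia. Qed.

Lemma depth_gt0 r : 0 < r <= m -> 0 < depth r.
Proof. by rewrite -remains0 remainsE. Qed.

Lemma depth_peeled t r : t < m -> (depth r == t.+1) = (r == peeled t).
Proof.
move=> tm; have pr := remains_peeled tm; have := remainsS r tm.
case: (eqVneq r (peeled t)) => [->|_].
  by move: pr; rewrite !remainsE; lia.
by rewrite !remainsE; lia.
Qed.

Lemma depthP r : 0 < r <= m -> exists2 t, t < m & depth r = t.+1 /\ r = peeled t.
Proof.
move=> /depth_gt0; case E: (depth r) => [//|t] _; have := depth_le r; rewrite E => tm.
by exists t => //; split=> //; apply/eqP; rewrite -depth_peeled ?E.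
Qed.

Lemma depth_inj i j : i <= m -> j <= m -> depth i = depth j -> i = j.
Proof.
case: (posnP i) => [->|i0] im; case: (posnP j) => [->|j0] jm //.
- by move=> e; have := @depth_gt0 j; rewrite -e depth0; lia.
- by move=> e; have := @depth_gt0 i; rewrite e depth0; lia.
have [|t _ [-> ->]] := @depthP i; first by lia.
have [|u _ [-> ->]] := @depthP j; first by lia.
by case=> ->.
Qed.

(** What remains is an interval, so a position never goes before both of two
positions that surround it. *)
Lemma depth_between i j k : i < j -> j < k -> k <= m ->
  depth i <= depth j \/ depth k <= depth j.
Proof.
move=> ij jk km; case: (ltnP (depth j) (depth i)); last by left.
case: (ltnP (depth j) (depth k)); last by right.
rewrite -!remainsE => rk ri.
have : remains (depth j) j by apply: remains_convex ri rk _; lia.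
by rewrite remainsE ltnn.
Qed.

(** The entries of smaller depth include position 0, of depth 0; hence w r' is
also the side of f 0 on which f r' lies. *)
Definition outward (f : nat -> nat) : Prop :=
  forall r r', r <= m -> depth r < depth r' -> dlt (w r') (f r) (f r').

(** As depth r <= m, the subtraction does not truncate. *)
Definition spiral (r : nat) : nat := if w r then m + depth r else m - depth r.

Lemma outward_spiral : outward spiral.
Proof.
move=> r r' _; have := depth_le r'; rewrite /spiral /dlt.
by case: (w r'); case: (w r); lia.
Qed.

(* Then the end m is peeled at the first step, whatever its letter. *)
Hypothesis w_end : forall r, m < r -> w r = w m.

Lemma peeled_leftP t : t < m -> leftward t ->
  [/\ peeled t = lo t, up t.+1 = up t, up t <= m,
     w (peeled t) = w (up t).-1 & w (up t) = ~~ w (peeled t)].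
Proof.
move=> tm left_t; rewrite /peeled upS // left_t subn0.
move: left_t; rewrite /leftward /peels_left => /andP[/eqP wl wu].
split=> //; last by rewrite wl; case: (w (up t)) (w (up t).-1) wu => [] [].
rewrite leqNgt; apply: contraNN wu => mu; have := up_le (ltnW tm).
by move=> um; have -> : up t = m.+1 by [lia]; rewrite /= w_end.
Qed.

(** A leftward step keeps h and up, whose letters differ.  A rightward step taken
because the letters of the two ends differ gives up a letter other than that of
lo.  So lo, h and up share a letter only as long as all steps have peeled the
right end and met a single letter there. *)
Lemma peeled_right_sync t : t < m -> w (lo t) = w (up t).-1 -> w (up t).-1 = w (up t) ->
  forall r, up t <= r -> w r = w (up t).
Proof.
elim: t => [|t IH] tm.
  rewrite /up /= => _ _ r mr; rewrite w_end; last by lia.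
  by rewrite [RHS]w_end; lia.
rewrite upS; last by lia.
rewrite loS; case E: (leftward t) => /=.
  rewrite subn0 addn1 => _ wu; move: E; rewrite /leftward /peels_left wu eqxx.
  by rewrite andbF.
rewrite addn0 subn1 => wl wu r ur.
move: E; rewrite /leftward /peels_left wl wu eqxx /= => /negbFE/eqP wu'.
case: (ltnP r (up t)) => ru; first by congr w; lia.
by rewrite (IH _ _ wu') //; [lia|rewrite wl].
Qed.

Lemma peeled_rightP t : t < m -> ~~ leftward t ->
  [/\ peeled t = (up t).-1, up t.+1 = peeled t &
     w (lo t) = ~~ w (peeled t) \/ forall r, peeled t <= r -> w r = w (peeled t)].
Proof.
move=> tm right_t; rewrite /peeled upS // (negbTE right_t) subn1; split=> //.
move: right_t; rewrite /leftward /peels_left.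
case: eqP => [wl /= /negbNE/eqP wu|wl _]; last first.
  by left; case: (w (lo t)) (w (up t).-1) wl => [] [].
right=> r ur; case: (ltnP r (up t)) => ru; first by congr w; lia.
by rewrite wu (peeled_right_sync tm wl wu).
Qed.

Lemma spiral_inj i j : i <= m -> j <= m -> spiral i = spiral j -> i = j.
Proof.
move=> im jm eij; apply: depth_inj => //; have := depth_le i; have := depth_le j.
by move: eij; rewrite /spiral; case: (w i); case: (w j); lia.
Qed.

(** * Outward sequences avoid *)

Section OutwardWitness.

Variables (f : nat -> nat) (b : bool) (i j k : nat).
Hypotheses (out : outward f) (ij : i < j) (jk : j < k) (km : k <= m).
Hypotheses (fij : dlt b (f i) (f j)) (fjk : dlt b (f j) (f k)).

Let fik : dlt b (f i) (f k) := dlt_trans fij fjk.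

Let side r r' : r <= m -> depth r < depth r' -> dlt b (f r) (f r') -> w r' = b.
Proof. by move=> rm /(out rm) rr' d; exact: dlt_orient d rr'. Qed.

Let sideN r r' : r <= m -> depth r < depth r' -> dlt b (f r') (f r) -> w r' = ~~ b.
Proof. by move=> rm /(out rm) rr'; rewrite -dltN => d; exact: dlt_orient d rr'. Qed.

Let near r : w r = b -> 0 < r <= m -> dlt b (f 0) (f r).
Proof. by move=> wr /depth_gt0 dr; have := @out 0 r (leq0n m); rewrite depth0 wr; apply. Qed.

Let nearN r : w r = ~~ b -> 0 < r <= m -> dlt b (f r) (f 0).
Proof.
by move=> wr /depth_gt0 dr; have := @out 0 r (leq0n m); rewrite depth0 wr dltN; apply.
Qed.

(** As i and j outlast k and have values before that of k, they lie before f 0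
in the direction b.  If k does so too, position 0 is the witness.  Otherwise
consider the step that peels j.  Since i still remains, it is a rightward step,
and k shows that the letters from j on are mixed.  Hence the left end carries
the letter b; it outlasts k, and so its value lies beyond that of k. *)
Lemma witnessed_right_shallower : depth k < depth i -> witnessed m f b i k.
Proof.
move=> dik.
have dkj : depth k < depth j.
  case: (depth_between ij jk km) => [|le_kj]; first by lia.
  by rewrite ltn_neqAle le_kj andbT; apply/eqP => /depth_inj; lia.
have wi := sideN km dik fik; have wj := sideN km dkj fjk.
have i0 : 0 < i by case: (posnP i) dik => // ->; rewrite depth0.
case: (eqVneq (w k) b) => wk; last first.
  have {}wk : w k = ~~ b by move: wk; case: (w k) (b) => [] [].
  by exists 0 => //; left; split=> //; apply: nearN => //; lia.
have dji : depth j < depth i.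
  case: (ltngtP (depth j) (depth i)) => // d; last by have := depth_inj _ _ d; lia.
  by have := @side i j _ d fij; rewrite wj; case: (b) => /=; lia.
have [|u um [dj pj]] := @depthP j; first by lia.
have ri : remains u i by rewrite remainsE; lia.
have [|_ _] := peeled_rightP um; first by apply: rightward_peeled ri _; lia.
rewrite -pj wj negbK => -[wl|all_right]; last first.
  by have := all_right k (ltnW jk); rewrite wk; case: (b).
have rl := remains_lo um; exists (lo u); first exact: remains_le rl.
left; split.
  rewrite ltn_neqAle; apply/andP; split; last by move: ri; rewrite /remains; lia.
  by apply/eqP => e; move: wl; rewrite e wi; case: (b).
by rewrite -wl; apply: out => //; move: rl; rewrite remainsE; lia.
Qed.

(** Peeling a position of the triple other than k while k remains means peeling
at the left end.  The rule then gives its letter to the right end and the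
opposite letter to the position after it; one of these two is the witness. *)
Lemma witnessed_left_shallower : depth i < depth k -> witnessed m f b i k.
Proof.
move=> dik.
have dij : depth i < depth j.
  case: (depth_between ij jk km) => [le_ij|]; last by lia.
  by rewrite ltn_neqAle le_ij andbT; apply/eqP => /depth_inj; lia.
have im : i <= m by lia.
have wk := side im dik fik; have wj := side im dij fij.
case: (posnP i) => i0.
(* With i = 0 the right neighbour at the time when j is peeled is the witness. *)
- have djk : depth j < depth k.
    case: (ltngtP (depth j) (depth k)) => // d; last by have := depth_inj _ _ d; lia.
    by have := @sideN k j _ d fjk; rewrite wj; case: (b) => /=; lia.
  have [|t tm [dj pj]] := @depthP j; first by lia.
  have rk : remains t k by rewrite remainsE; lia.
  have [|_ _ um _ wu] := peeled_leftP tm; first by apply: leftward_peeled rk _; lia.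
  exists (up t) => //; right; split; first by move: rk; rewrite /remains; lia.
  by rewrite i0; apply: nearN; rewrite -?pj ?wj in wu *;
    rewrite ?wu ?um //; have := lo_lt_up tm; lia.
- have [|t tm [di pi]] := @depthP i; first by lia.
  have rk : remains t k by rewrite remainsE; lia.
  have [|_ _ um wh wu] := peeled_leftP tm; first by apply: leftward_peeled rk _; lia.
  rewrite -pi in wh wu; have ku : k < up t by case/andP: rk.
  case: (eqVneq (w i) b) => wi.
  (* When f i lies beyond f 0, the peeled right neighbour lies before f 0. *)
  + exists (up t) => //; right; split=> //.
    apply: (@dlt_trans _ (f 0)); last by apply: near; rewrite // i0.
    by apply: nearN; rewrite ?wu ?wi // um andbT; exact: leq_ltn_trans ku.
  (* Otherwise the right end still remains, and lies farther than f i. *)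
  + have {}wi : w i = ~~ b by move: wi; case: (w i) (b) => [] [].
    have rh := remains_up tm; exists (up t).-1; first exact: remains_le rh.
    have hk : (up t).-1 != k by apply/eqP => e; move: wh; rewrite e wk wi; case: (b).
    have kh : k < (up t).-1 by clear -hk ku; lia.
    right; split=> //; have dh : depth i < depth (up t).-1.
      have := remainsS (up t).-1 tm; rewrite rh -pi remainsE -di => ->.
      by rewrite neq_ltn (ltn_trans (ltn_trans ij jk) kh) orbT.
    by rewrite -dltN -wi wh; apply: out.
Qed.

End OutwardWitness.

Lemma outward_mesh_avoiding f : outward f -> mesh_avoiding m f.
Proof.
move=> out b i j k ij jk km fij fjk.
case: (ltngtP (depth i) (depth k)) => dik.
- exact: (witnessed_left_shallower out ij jk km fij fjk dik).
- exact: (witnessed_right_shallower out ij jk km fij fjk dik).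
- by have := depth_inj _ _ dik; lia.
Qed.

(** * Avoiding sequences are outward *)

Section AvoidingOutward.

Variable f : nat -> nat.
Hypothesis f_inj : forall i j, i <= m -> j <= m -> f i = f j -> i = j.
Hypothesis wf : forall r, 0 < r <= m -> w r = (f 0 < f r).
Hypothesis avoid : mesh_avoiding m f.

Let f_neq i j : i <= m -> j <= m -> i != j -> f i != f j.
Proof. by move=> im jm; apply: contra_neq; apply: f_inj. Qed.

Let near r : 0 < r <= m -> dlt (w r) (f 0) (f r).
Proof.
move=> rm; rewrite wf //; have := @f_neq 0 r.
by rewrite /dlt; case: (ltnP (f 0) (f r)); lia.
Qed.

Definition outside (t : nat) : Prop :=
  forall r r', r <= m -> ~~ remains t r -> remains t r' -> dlt (w r') (f r) (f r').

(** When the left end is peeled, up t serves as the last position of a monotone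
triple; this excludes a witness to the left of that triple. *)
Definition extremal_up (t : nat) : Prop :=
  up t <= m -> forall r, r <= m -> ~~ remains t r -> r != up t ->
  dlt (w (up t)) (f r) (f (up t)).

(** If a remaining r' with the letter of the peeled position p were closer to
f 0 than p, then p and r' would complete to a monotone triple.  Its witness
lies outside the interval and so is already peeled; depending on the triple,
outside, extremal_up or the constancy of the letters to the right of p shows
that its value is on the wrong side. *)
Lemma peeled_innermost t r' : t < m -> outside t -> extremal_up t ->
  remains t r' -> r' != peeled t -> dlt (w r') (f (peeled t)) (f r').
Proof.
move=> tm inv ext rr' r'p; have lu := lo_lt_up tm; have pr := remains_peeled tm.
have pm := remains_le pr; have p0 := remains_gt0 pr.
have r'm := remains_le rr'; have r'0 := remains_gt0 rr'.
case: (eqVneq (w r') (w (peeled t))) => [wr'|wr']; last first.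
  have {}wr' : w r' = ~~ w (peeled t) by move: wr'; case: (w r') (w (peeled t)) => [] [].
  apply: (@dlt_trans _ (f 0)); last by apply: near; rewrite r'0.
  by rewrite wr' dltN; apply: near; rewrite p0.
have pr'_neq : f (peeled t) != f r' by apply: f_neq => //; rewrite eq_sym.
have [//|bad] := dlt_total (w r') pr'_neq.
case: (boolP (leftward t)) => [/(peeled_leftP tm) | /(peeled_rightP tm)]; last first.
- move=> [ph _ wlo].
  have r'h : r' < peeled t by move: rr' r'p; rewrite ph /remains; lia.
  case: wlo.
  (* The triple is lo t, r', p. *)
  + move=> wl; have rl := remains_lo tm.
    have lr' : lo t < r'.
      rewrite ltn_neqAle; apply/andP; split; last by move: rr'; rewrite /remains; lia.
      by apply/eqP => e; move: wl; rewrite e wr'; case: (w _).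
    have wl' : w (lo t) = ~~ w r' by rewrite wr'.
    have lm := remains_le rl; have l0 := remains_gt0 rl.
    have dl : dlt (w r') (f (lo t)) (f r').
      apply: (@dlt_trans _ (f 0)); last by apply: near; rewrite r'0.
      by rewrite -dltN -wl'; apply: near; rewrite l0.
    have [r rm [[rl' d]|[hr d]]] := avoid lr' r'h pm dl bad.
      have nr := remains_ltN rl'.
      by have := inv _ _ rm nr pr; rewrite -wr' => /dlt_asym/(_ d).
    have nr : ~~ remains t r.
      by apply: remains_geN; rewrite ph in hr; exact: leq_trans (leqSpred _) hr.
    by have := inv _ _ rm nr rl; rewrite wl' dltN => /dlt_asym/(_ d).
  (* The triple is 0, r', p. *)
  + move=> all_right.
    have d0 : dlt (w r') (f 0) (f r') by apply: near; rewrite r'0.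
    have [r rm [[//]|[hr d]]] := avoid r'0 r'h pm d0 bad.
    have r0 : 0 < r <= m by rewrite rm; lia.
    by have := near r0; rewrite all_right 1?ltnW // -wr' => /dlt_asym/(_ d).
(* The triple is p, r', up t, monotone in the direction w (up t). *)
- move=> [pl _ um _ wu].
  have lr' : peeled t < r' by move: rr' r'p; rewrite pl /remains; lia.
  have r'u : r' < up t by move: rr'; rewrite /remains; lia.
  have nu := remains_geN (leqnn (up t)).
  have d1 : dlt (w (up t)) (f (peeled t)) (f r') by rewrite wu -wr' dltN.
  have d2 : dlt (w (up t)) (f r') (f (up t)) by rewrite wu -wr' dltN; apply: inv.
  have [r rm [[rl' d]|[hr d]]] := avoid lr' r'u um d1 d2.
    have nr : ~~ remains t r by apply: remains_ltN; rewrite -pl.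
    have ru : r != up t by rewrite neq_ltn (ltn_trans rl' (ltn_trans lr' r'u)).
    by have := ext um r rm nr ru => /dlt_asym/(_ d).
  have nr := remains_geN (ltnW hr).
  by have := inv _ _ rm nr pr; rewrite -dltN -wu => /dlt_asym/(_ d).
Qed.

Lemma mesh_avoiding_outward : outward f.
Proof.
suff inv t : t <= m -> outside t /\ extremal_up t.
  move=> r r' rm dr; have [|+ _] := inv (depth r); first exact: depth_le.
  by apply=> //; rewrite remainsE // ltnn.
elim: t => [_|t IH tm].
  split=> [r r' rm|]; last by rewrite /extremal_up /up /=; lia.
  rewrite !remains0 rm andbT -leqNgt leqn0 => /eqP-> r'm; exact: near.
have [inv ext] := IH (ltnW tm); have lu := lo_lt_up tm; have pr := remains_peeled tm.
split=> [r r' rm|um r rm]; rewrite !remainsS //.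
  rewrite negb_and negbK => nr /andP[rr' r'p].
  by case/orP: nr => [nr|/eqP->]; [apply: inv|apply: peeled_innermost].
rewrite negb_and negbK => nr ru.
case: (boolP (leftward t)) => [/(peeled_leftP tm) | /(peeled_rightP tm)].
- move=> [pl ue _ _ wu]; rewrite ue in ru um *.
  case/orP: nr => [nr|/eqP->]; first exact: ext.
  by rewrite wu dltN; apply: inv => //; rewrite /remains; lia.
- move=> [_ ue _]; rewrite ue; apply: inv => //.
  by move: nr ru; rewrite ue => /orP[//|->].
Qed.

End AvoidingOutward.

End Peeling.

(** * Occurrences of the two mesh patterns *)

Definition mono3 (b : bool) : mesh_pattern := if b then A3 else D3.

Section MonotoneOccurrences.
Variables (n : nat) (s : 'S_n).

Definition triple (i j k : 'I_n) : {ffun 'I_3 -> 'I_n} :=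
  [ffun a : 'I_3 => nth i [:: i; j; k] a].

Lemma enum_I3 : enum 'I_3 = [:: inord 0; inord 1; inord 2].
Proof.
by apply: (inj_map val_inj); rewrite val_enum_ord /= !inordK.
Qed.

Lemma tripleP (f : {ffun 'I_3 -> 'I_n}) : exists i j k, f = triple i j k.
Proof.
exists (f (inord 0)), (f (inord 1)), (f (inord 2)); apply/ffunP => a.
rewrite ffunE; case: a => [[|[|[|//]]] p] /=; congr (f _); apply: val_inj; rewrite /= inordK //.
Qed.

Lemma occ_positions_triple i j k :
  occ_positions (triple i j k) = [:: 0; i.+1; j.+1; k.+1; n.+1].
Proof. by rewrite /occ_positions enum_I3 /= !ffunE !inordK. Qed.

Lemma occ_values_triple b i j k :
  dlt b (s i) (s j) -> dlt b (s j) (s k) ->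
  occ_values s (triple i j k) =
    [:: 0; (s (if b then i else k)).+1; (s j).+1; (s (if b then k else i)).+1; n.+1].
Proof.
rewrite /occ_values enum_I3 /= !ffunE !inordK //= => ij jk; congr (0 :: _).
rewrite -[RHS]/(rcons [:: _; _; _] _); congr rcons.
apply: (sorted_eq leq_trans anti_leq); first exact: (sort_sorted leq_total).
  by move: ij jk; rewrite /dlt; case: b; rewrite /= andbT; lia.
rewrite perm_sort; case: b {ij jk} => //.
by rewrite -[X in perm_eq X _](revK) perm_rev.
Qed.

Lemma increasing_triple i j k : increasing_indices (triple i j k) = (i < j < k).
Proof.
apply/forallP/idP => [inc|/andP[ij jk] a].
  have /forallP/(_ (inord 1)) := inc (inord 0); have /forallP/(_ (inord 2)) := inc (inord 1).
  by rewrite !ffunE !inordK //= => -> ->.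
apply/forallP => c; apply/implyP; rewrite !ffunE.
by case: a c => [[|[|[|//]]] p] [[|[|[|//]]] q] //= _; apply: ltn_trans jk.
Qed.

Lemma order_isomorphic_triple (pi : 'S_3) b i j k :
  (forall a c, (pi a < pi c) = dlt b a c) ->
  order_isomorphic s (triple i j k) pi = dlt b (s i) (s j) && dlt b (s j) (s k).
Proof.
move=> pib; apply/forallP/andP => [iso|[ij jk] a].
  split.
    have /forallP/(_ (inord 1)) := iso (inord 0); have /forallP/(_ (inord 0)) := iso (inord 1).
    by rewrite !pib !ffunE /dlt !inordK //=; case: (b) => /eqP e1 /eqP e2; rewrite ?e1 ?e2.
  have /forallP/(_ (inord 1)) := iso (inord 2); have /forallP/(_ (inord 2)) := iso (inord 1).
  by rewrite !pib !ffunE /dlt !inordK //=; case: (b) => /eqP e1 /eqP e2; rewrite ?e1 ?e2.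
apply/forallP => c; rewrite pib !ffunE; apply/eqP; move: ij jk; rewrite /dlt.
by case: (b); case: a c => [[|[|[|//]]] p] [[|[|[|//]]] q] //=; lia.
Qed.

Lemma shade2 (c d : 'I_4 * 'I_4) (P : pred ('I_4 * 'I_4)) :
  [forall x in [set c; d], P x] = P c && P d.
Proof.
apply/forall_inP/andP => [h|[pc pd] x]; first by rewrite !h ?set21 ?set22.
by case/set2P => ->.
Qed.

Definition unwitnessed b (i j k : 'I_n) : bool :=
  [&& i < j < k, dlt b (s i) (s j) && dlt b (s j) (s k) &
     [forall r : 'I_n, ~~ ((r < i) && dlt b (s k) (s r) || (k < r) && dlt b (s r) (s i))]].

Definition mono3_shade (b : bool) : {set 'I_4 * 'I_4} :=
  [set (ord0, if b then ord_max else ord0); (ord_max, if b then ord0 else ord_max)].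

Lemma is_occurrence_triple b (pi : 'S_3) i j k :
  (forall a c, (pi a < pi c) = dlt b a c) ->
  is_occurrence (p := MeshPattern pi (mono3_shade b)) s (triple i j k) =
  unwitnessed b i j k.
Proof.
move=> pib; rewrite /is_occurrence increasing_triple.
rewrite (order_isomorphic_triple _ _ _ pib) /unwitnessed.
case: (_ < _ < _) => //=.
case: (boolP (dlt b (s i) (s j) && dlt b (s j) (s k))) => //= /andP[ij jk].
have cells r : in_cell s (triple i j k) 0 (if b then 3 else 0) r
    = (r < i) && dlt b (s k) (s r) /\
  in_cell s (triple i j k) 3 (if b then 0 else 3) r = (k < r) && dlt b (s r) (s i).
  rewrite /in_cell occ_positions_triple (occ_values_triple ij jk) /dlt.
  by have := ltn_ord r; have := ltn_ord (s r); case: (b) => /=; lia.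
rewrite shade2 /= !(fun_if (@nat_of_ord 4)) /=.
apply/andP/forallP => [[/forallP h1 /forallP h2] r|h].
  by have := h1 r; have := h2 r; rewrite !(cells r).1 !(cells r).2 negb_or => -> ->.
by split; apply/forallP => r; have := h r; rewrite ?(cells r).1 ?(cells r).2 negb_or => /andP[].
Qed.

Lemma contains_mono3 b :
  contains (mono3 b) s = [exists i, exists j, exists k, unwitnessed b i j k].
Proof.
have gen (pi : 'S_3) : (forall a c, (pi a < pi c) = dlt b a c) ->
    contains (MeshPattern pi (mono3_shade b)) s =
    [exists i, exists j, exists k, unwitnessed b i j k].
  move=> pib; apply/existsP/existsP => [[f]|[i /existsP[j /existsP[k]]]].
    have [i [j [k ->]]] := tripleP f; rewrite is_occurrence_triple // => ijk.
    by exists i; apply/existsP; exists j; apply/existsP; exists k.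
  by rewrite -(is_occurrence_triple _ _ _ pib); exists (triple i j k).
case: b gen => gen; apply: gen => a c; first by rewrite !perm1.
by rewrite !permE /= /dlt; have := ltn_ord a; have := ltn_ord c; lia.
Qed.

End MonotoneOccurrences.

Definition values (m : nat) (s : 'S_m.+1) (r : nat) : nat := s (inord r).

Lemma avoidersP m (s : 'S_m.+1) :
  reflect (mesh_avoiding m (values s)) (s \in avoiders m.+1 A3 D3).
Proof.
have -> : (s \in avoiders m.+1 A3 D3) = [forall b, ~~ contains (mono3 b) s].
  rewrite inE; apply/andP/forallP => [[hA hD] []|h] //.
  by split; [apply: (h true)|apply: (h false)].
apply: (iffP forallP) => [av b i j k ij jk km fij fjk|av b].
  have := av b; rewrite contains_mono3 => /existsPn/(_ (inord i)).
  move=> /existsPn/(_ (inord j))/existsPn/(_ (inord k)).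
  rewrite /unwitnessed !inordK ?ij ?jk; try lia.
  rewrite [dlt b _ _]fij [dlt b _ _]fjk /= => /forallPn[r]; rewrite negbK => rw.
  exists r; first by rewrite -ltnS.
  by rewrite /values inord_val; case/orP: rw => /andP[]; [left|right].
rewrite contains_mono3; apply/existsPn => i; apply/existsPn => j; apply/existsPn => k.
apply/and3P => -[/andP[ij jk] /andP[fij fjk] /forallP w].
have := av b i j k ij jk; rewrite /witnessed /values !inord_val -ltnS ltn_ord => /(_ isT fij fjk).
case=> r rm rw; have := w (inord r); rewrite inordK //.
by case: rw => -[-> ->]; rewrite ?orbT.
Qed.

(** * Avoiders and words *)

(** Depths and letters alone decide the order of an outward sequence. *)
Lemma outward_ltE m w f i j : outward m w f -> i <= m -> j <= m ->
  (f i < f j) = (spiral m w i < spiral m w j).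
Proof.
move=> out im jm; have sp := @outward_spiral m w.
case: (ltngtP (depth m w i) (depth m w j)) => [d|d|/depth_inj->//].
- by have := out _ _ im d; have := sp _ _ im d; rewrite /dlt; case: (w j); lia.
- by have := out _ _ jm d; have := sp _ _ jm d; rewrite /dlt; case: (w i); lia.
by rewrite !ltnn.
Qed.

(** This recovers a permutation from the order of its entries. *)
Lemma perm_rank n (s : 'S_n) i : s i = #|[set j | s j < s i]| :> nat.
Proof.
have -> : [set j | s j < s i] = s @^-1: [set k : 'I_n | k < s i].
  by apply/setP => j; rewrite !inE.
rewrite card_preimset; last exact: perm_inj.
have := ltn_ord (s i); move: (nat_of_ord (s i)) => v vn.
rewrite -sum1_card; have := @big_ord_widen _ 0 addn v n (fun=> 1) (ltnW vn).
by rewrite big_const_ord iter_addn_0 mul1n => {1}->; apply: eq_bigl => k; rewrite inE.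
Qed.

Lemma values_inj m (s : 'S_m.+1) i j : i <= m -> j <= m -> values s i = values s j -> i = j.
Proof.
by move=> im jm /val_inj/perm_inj/(congr1 val); rewrite /= !inordK.
Qed.

Lemma perm_of_key m (f : nat -> nat) :
  (forall i j, i <= m -> j <= m -> f i = f j -> i = j) ->
  exists s : 'S_m.+1, forall i j, i <= m -> j <= m ->
    (values s i < values s j) = (f i < f j).
Proof.
move=> f_inj; pose low (i : 'I_m.+1) := [set j : 'I_m.+1 | f j < f i].
have lowS (i j : 'I_m.+1) : f i < f j -> low i \proper low j.
  move=> fij; apply/properP; split; last by exists i; rewrite !inE ?ltnn.
  by apply/subsetP => k; rewrite !inE => /ltn_trans; apply.
have low_lt i : #|low i| < m.+1.
  rewrite -[X in _ < X]card_ord -cardsT; apply: proper_card.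
  by rewrite properT; apply/negP => /eqP/setP/(_ i); rewrite !inE ltnn.
have rankE (i j : 'I_m.+1) : (#|low i| < #|low j|) = (f i < f j).
  case: (ltngtP (f i) (f j)) => [/lowS/proper_card //|/lowS/proper_card|].
    by lia.
  by move=> e; rewrite /low e ltnn.
have rank_inj : injective (fun i => Ordinal (low_lt i)).
  move=> i j /(congr1 (@nat_of_ord _)) /= e; apply: val_inj.
  apply: f_inj; [exact: leq_ord|exact: leq_ord|].
  by case: (ltngtP (f i) (f j)) => // /lowS/proper_card; rewrite e ltnn.
exists (perm rank_inj) => i j im jm.
by rewrite /values !permE /= rankE !inordK.
Qed.

Definition side_word (m : nat) (s : 'S_m.+1) : m.-tuple bool :=
  [tuple values s 0 < values s i.+1 | i < m].

(** The default is the last letter, which makes the word constant from m on; the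
letter at position 0 carries no information. *)
Definition letter (m : nat) (u : m.-tuple bool) (r : nat) : bool :=
  nth (last false u) u r.-1.

Lemma letter_end m (u : m.-tuple bool) r : m < r -> letter u r = letter u m.
Proof.
move=> mr; rewrite /letter nth_default ?size_tuple; last by lia.
by rewrite -[in m.-1](size_tuple u) -nth_last; case: (tval u) => //= *; apply: set_nth_default.
Qed.

Lemma letter_side_word m (s : 'S_m.+1) r : 0 < r <= m ->
  letter (side_word s) r = (values s 0 < values s r).
Proof.
case: r => // r rm.
by rewrite /letter -(tnth_nth _ _ (Ordinal (rm : r < m))) tnth_mktuple.
Qed.

Lemma avoiders_outward m (s : 'S_m.+1) :
  (s \in avoiders m.+1 A3 D3) -> outward m (letter (side_word s)) (values s).
Proof.
move=> /avoidersP; apply: mesh_avoiding_outward => [||r]; first exact: letter_end.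
  exact: values_inj.
exact: letter_side_word.
Qed.

Lemma side_word_inj m : {in avoiders m.+1 A3 D3 &, injective (@side_word m)}.
Proof.
move=> s s' /avoiders_outward out /avoiders_outward out' e; rewrite e in out.
apply/permP => i; apply: val_inj; rewrite /= (perm_rank s) (perm_rank s'); congr #|pred_of_set _|.
apply/setP => j; rewrite !inE.
have := outward_ltE out (leq_ord j) (leq_ord i).
by rewrite -(outward_ltE out' (leq_ord j) (leq_ord i)) /values !inord_val.
Qed.

Lemma side_word_surj m (u : m.-tuple bool) :
  exists2 s : 'S_m.+1, s \in avoiders m.+1 A3 D3 & u = side_word s.
Proof.
have [s sE] := perm_of_key (@spiral_inj m (letter u)).
(* A position beyond m has depth 0, so r' is a position of s. *)
have out : outward m (letter u) (values s).
  move=> r r' rm d; have := outward_spiral rm d; have r'm : r' <= m.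
    case: (leqP r' m) => // mr'; move: d; rewrite -remainsE => /remains_le; lia.
  by rewrite /dlt !sE.
exists s; first by apply/avoidersP; apply: outward_mesh_avoiding out; apply: letter_end.
apply: eq_from_tnth => i; rewrite tnth_mktuple; have im := ltn_ord i.
have := out 0 i.+1 (leq0n m); rewrite depth0 depth_gt0 ?ltn_ord // => /(_ isT).
rewrite /letter /= -tnth_nth /dlt; case: (tnth u i) => //.
by move=> lt; rewrite ltnNge ltnW.
Qed.

Theorem theorem3p3 : forall n : nat, 1 <= n -> #|avoiders n A3 D3| = 2 ^ (n - 1).
Proof.
case=> // m _; rewrite subn1 /= -card_bool -card_tuple -cardsT.
rewrite -(card_in_imset (@side_word_inj m)); apply: eq_card => u; rewrite inE.
by have [s av ->] := side_word_surj u; apply: imset_f.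
Qed.
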